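(* Let $m,n\in\mathbb{N}=\{1,2,\dotsc\}$. Then for all $z\in\mathbb{C}$, $$ {}_2F_1\Bigl(-\frac{n}{2},\frac{1-n}{2};\frac{1}{2}-m;z^2\Bigr) =\frac{n!}{2\binom{2m}{m}}\sum_{k=0}^{m}\frac{2^k}{k!}\binom{2m-2k}{m-k}\sum_{\ell=0}^{k}\frac{(2k-2\ell-1)!!}{(n-\ell)!}\binom{2k-\ell-1}{\ell-1}\bigl[(1-z)^{n-\ell}+(-1)^{\ell}(1+z)^{n-\ell}\bigr]z^\ell, $$ where $\frac{1}{(n-\ell)!}=0$ when $\ell>n$, and the corresponding terms are read as $0$ for every $z$, including $z=\pm1$.
   Context: The Gauss hypergeometric function is ${}_2F_1(a,b;c;x)=\sum_{j=0}^\infty\frac{(a)_j(b)_j}{(c)_j}\frac{x^j}{j!}$ with $c\notin\{0,-1,-2,\dotsc\}$, where $(x)_j=x(x+1)\dotsm(x+j-1)$ and $(x)_0=1$. Here one of the upper parameters is a nonpositive integer, so the series terminates and is a polynomial in $z$. Double factorials: $(2r-1)!!=1\cdot3\dotsm(2r-1)$ for $r\ge1$ and $(-1)!!=1$. Extended binomial coefficients: for integer $w\ge0$, $\binom{x}{w}=\frac{x(x-1)\dotsm(x-w+1)}{w!}$; for integer $w<0$ and $x$ not a negative integer, $\binom{x}{w}=0$; and $\binom{-1}{-1}=1$. (Thus $\binom{2k-\ell-1}{\ell-1}$ equals $1$ for $k=\ell=0$, and equals $0$ for $k\ge1$, $\ell=0$.) The convention $w^0=1$ for all $w$ is used. *)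

(* Defs.v *)
From HB Require Import structures.
From mathcomp Require Import all_boot all_order all_algebra.
From mathcomp Require Import complex.
From mathcomp Require Import all_classical all_reals all_analysis.

Set Implicit Arguments.
Unset Strict Implicit.
Unset Printing Implicit Defensive.

Import Order.TTheory GRing.Theory Num.Theory.
Import numFieldNormedType.Exports.

Local Open Scope ring_scope.

Definition poch (K : numFieldType) (x : K) (j : nat) : K :=
  \prod_(i < j) (x + i%:R).

(* The limit of the partial sums, hence meaningful where the series converges
   and [c] is not a nonpositive integer. *)
Definition hyp2F1 (K : numFieldType) (a b c x : K) : K :=
  limn (series (fun j : nat =>
    poch a j * poch b j / poch c j * (x ^+ j / j`!%:R))).

(* (2r-1)!! as a function of r, so that r = 0 gives (-1)!! = 1. *)
Definition odd_dfact (r : nat) : nat := \prod_(i < r) (2 * i + 1)%N.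

(* For w < 0 the value is conventional: 1 at (-1, -1), and 0 when x is not a
   negative integer.  At the remaining pairs of negative integers, where no
   convention is fixed, the value 0 is a placeholder. *)
Definition ext_binom (K : numFieldType) (x : K) (w : int) : K :=
  match w with
  | Posz w => (\prod_(i < w) (x - i%:R)) / w`!%:R
  | Negz _ => if (x == -1) && (w == -1) then 1 else 0
  end.

(* Main.v *)
(** Since (-n/2)_j ((1-n)/2)_j = n^_(2j) / 4^j and (1/2)_j / (1/2-m)_j =
    (1/2-j)_m / (1/2)_m, the left-hand side is the even part in z of the sum
    over N of C(n,N) p(N) z^N, where p(N) = ((1-N)/2)_m / (1/2)_m is a
    polynomial in N.  Conversely, n!/(n-l)! (1+z)^(n-l) z^l is the sum over
    N of C(n,N) N^_l z^N, so the right-hand side comes from expanding p in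
    falling factorials.  That expansion has two steps: the Chu-Vandermonde
    identity for ((1-N)/2)_m = (-N/2 + 1/2)_m gives the factors binom(2m-2k,
    m-k), and the expansion of 2^k (-N/2)_k in falling factorials has the
    coefficients of the Bessel polynomials, checked by their two-term
    recurrence. *)

Require Import Defs.
From HB Require Import structures.
From mathcomp Require Import all_boot all_order all_algebra.
From mathcomp Require Import complex ring zify.
From mathcomp Require Import all_classical all_reals all_analysis.

Import Order.TTheory GRing.Theory Num.Theory.
Import numFieldNormedType.Exports.

Local Open Scope ring_scope.
Local Open Scope complex_scope.

(** * Rising factorials and the Chu-Vandermonde identity *)

Lemma fact_natr_neq0 (K : numFieldType) (k : nat) : k`!%:R != 0 :> K.
Proof. by rewrite pnatr_eq0 -lt0n fact_gt0. Qed.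

Lemma poch0 (K : numFieldType) (x : K) : poch x 0 = 1.
Proof. by rewrite /poch big_ord0. Qed.

Lemma pochSr (K : numFieldType) (x : K) (j : nat) :
  poch x j.+1 = poch x j * (x + j%:R).
Proof. by rewrite /poch big_ord_recr. Qed.

Lemma pochSl (K : numFieldType) (x : K) (j : nat) :
  poch x j.+1 = x * poch (x + 1) j.
Proof.
rewrite /poch big_ord_recl /= addr0; congr (_ * _).
by apply: eq_bigr => i _; rewrite /bump /= natrD addrA.
Qed.

(** Induction on m: Pascal's rule matches the splitting x + y + m = (x + i) + (y + m - i) of the new
    factor. *)
Lemma poch_vandermonde (K : numFieldType) (x y : K) (m : nat) :
  poch (x + y) m =
  \sum_(0 <= i < m.+1) 'C(m, i)%:R * poch x i * poch y (m - i).
Proof.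
elim: m => [|m IHm]; first by rewrite big_nat1 !poch0 !mulr1.
rewrite pochSr IHm mulr_suml.
rewrite [RHS]big_nat_recl // bin0 poch0 !mul1r subn0.
under [X in _ = _ + X]eq_bigr => i _ do
  rewrite binS natrD subSS 2!mulrDl.
rewrite big_split /= addrA.
have -> : poch y m.+1 +
    \sum_(0 <= i < m.+1) 'C(m, i.+1)%:R * poch x i.+1 * poch y (m - i) =
    \sum_(0 <= i < m.+1) 'C(m, i)%:R * poch x i * poch y (m.+1 - i).
  rewrite [in RHS]big_nat_recl // bin0 poch0 !mul1r subn0; congr (_ + _).
  rewrite big_nat_recr //= bin_small // !mul0r addr0.
  by apply: eq_bigr => i _; rewrite subSS.
rewrite -big_split /=; apply: eq_big_nat => i /andP[_ ltim].
by rewrite subSn // !pochSr natrB //; ring.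
Qed.

(** * Rising factorials at half-integers *)

Lemma half_shift_neq0 (K : numFieldType) (m i : nat) :
  1 / 2 - m%:R + i%:R != 0 :> K.
Proof.
have -> : 1 / 2 - m%:R + i%:R = ((2 * i).+1%:R - (2 * m)%:R) / 2 :> K.
  by rewrite -addn1 natrD !natrM; field.
rewrite mulf_neq0 ?invr_eq0 ?pnatr_eq0 // subr_eq0 eqr_nat.
by apply/eqP; lia.
Qed.

Lemma poch_half_shift_neq0 (K : numFieldType) (m j : nat) :
  poch (1 / 2 - m%:R) j != 0 :> K.
Proof. by apply/prodf_neq0 => i _; exact: half_shift_neq0. Qed.

Lemma poch_half_neq0 (K : numFieldType) (j : nat) : poch (1 / 2) j != 0 :> K.
Proof. by have := poch_half_shift_neq0 K 0 j; rewrite subr0. Qed.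

(** Trades the denominator (1/2 - m)_j, whose length grows with j, for (1/2 - j)_m, a polynomial in
    j of fixed degree m. *)
Lemma poch_half_exchange (K : numFieldType) (m j : nat) :
  poch (1 / 2) j * poch (1 / 2) m =
  poch (1 / 2 - m%:R) j * poch (1 / 2 - j%:R) m :> K.
Proof.
elim: j => [|j IHj]; first by rewrite !poch0 subr0.
have step : (1 / 2 - m%:R + j%:R) * poch (1 / 2 - j.+1%:R) m =
            (1 / 2 + j%:R) * poch (1 / 2 - j%:R) m :> K.
  (* The product of m + 1 factors starting at 1/2 - (j + 1) is split off at its first and at its
     last factor. *)
  have h := pochSl K (1 / 2 - j.+1%:R) m; rewrite pochSr in h.
  rewrite (_ : 1 / 2 - j%:R = 1 / 2 - j.+1%:R + 1); last first.
    by rewrite -natr1; ring.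
  have -> : 1 / 2 + j%:R = - (1 / 2 - j.+1%:R) :> K by rewrite -natr1; field.
  by rewrite mulNr -h -natr1; field.
by rewrite !pochSr mulrAC IHj -!mulrA step; ring.
Qed.

Lemma poch_half (K : numFieldType) (r : nat) :
  poch (1 / 2) r * (4 ^+ r * r`!%:R) = (2 * r)`!%:R :> K.
Proof.
elim: r => [|r IHr]; first by rewrite poch0 !mul1r.
rewrite (_ : (2 * r.+1 = (2 * r).+2)%N); last by lia.
rewrite pochSr exprS !factS !natrM -IHr -!natr1 natrM.
by field.
Qed.

Lemma odd_dfact_poch (K : numFieldType) (r : nat) :
  (odd_dfact r)%:R = 2 ^+ r * poch (1 / 2) r :> K.
Proof.
elim: r => [|r IHr]; first by rewrite poch0 /odd_dfact big_ord0 mulr1.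
rewrite pochSr exprS /odd_dfact big_ord_recr -/(odd_dfact r) natrM IHr /=.
by rewrite natrD natrM; field.
Qed.

Lemma central_bin (K : numFieldType) (r : nat) :
  'C(2 * r, r)%:R = 4 ^+ r * poch (1 / 2) r / r`!%:R :> K.
Proof.
have f0 := fact_natr_neq0 K r.
have := @bin_fact (2 * r) r; rewrite (_ : (2 * r - r = r)%N); last by lia.
move=> /(_ ltac:(lia)) /(congr1 (fun k => k%:R : K)).
rewrite /= -poch_half !natrM => h.
apply: (mulIf f0); apply: (mulIf f0); rewrite -[LHS]mulrA h; field.
exact: f0.
Qed.

(** * Binomial sums and the terms of the series *)

Lemma ffact_natrSr (K : numFieldType) (n l : nat) :
  (n ^_ l.+1)%:R = (n ^_ l)%:R * (n%:R - l%:R) :> K.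
Proof.
rewrite ffactnSr natrM; case: (leqP l n) => [len|ltnl].
  by rewrite natrB.
by rewrite ffact_small // !mul0r.
Qed.

Lemma poch_neg_halves (K : numFieldType) (n j : nat) :
  4 ^+ j * (poch (- n%:R / 2) j * poch ((1 - n%:R) / 2) j) =
  (n ^_ (2 * j))%:R :> K.
Proof.
elim: j => [|j IHj]; first by rewrite !poch0 !mulr1.
rewrite (_ : (2 * j.+1 = (2 * j).+2)%N); last by lia.
rewrite !ffact_natrSr -IHj !pochSr exprS -natr1 natrM.
by field.
Qed.

(** The numerator is n^_(2j) / 4^j, and (2j)! = 4^j (1/2)_j j!; the factor (1/2)_j so released turns
    1 / (1/2 - m)_j into (1/2 - j)_m / (1/2)_m. *)
Lemma hyp2F1_term (K : numFieldType) (m n j : nat) (z : K) :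
  poch (- n%:R / 2) j * poch ((1 - n%:R) / 2) j / poch (1 / 2 - m%:R) j *
    ((z ^+ 2) ^+ j / j`!%:R) =
  'C(n, 2 * j)%:R * poch ((1 - (2 * j)%:R) / 2) m / poch (1 / 2) m *
    z ^+ (2 * j).
Proof.
have f0 := fact_natr_neq0 K j.
have p0 := poch_half_neq0 K m.
have q0 := poch_half_shift_neq0 K m j.
have e0 : 4 ^+ j != 0 :> K by rewrite expf_neq0 // pnatr_eq0.
rewrite (_ : (1 - (2 * j)%:R) / 2 = 1 / 2 - j%:R :> K); last first.
  by rewrite natrM; field.
rewrite exprM.
have h1 := poch_neg_halves K n j.
have h2 := poch_half_exchange K m j.
have := congr1 (fun k => k%:R : K) (bin_ffact n (2 * j)).
rewrite /= -h1 natrM -poch_half => h3.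
have -> : poch (1 / 2 - j%:R) m =
    poch (1 / 2) j * poch (1 / 2) m / poch (1 / 2 - m%:R) j :> K.
  by rewrite h2 [in RHS]mulrC mulKf.
have -> : poch (- n%:R / 2) j * poch ((1 - n%:R) / 2) j =
   'C(n, 2 * j)%:R * (poch (1 / 2) j * j`!%:R) :> K.
  by apply: (mulfI e0); rewrite -h3; ring.
by field; rewrite f0 p0 q0.
Qed.

(** Both sides are z^l times the l-th derivative of (1 + z)^n; termwise, C(n,N) N^_l = n!/(n-l)!
    C(n-l,N-l). *)
Lemma falling_binomial_sum (K : numFieldType) (n l : nat) (z : K) :
  \sum_(0 <= N < n.+1) 'C(n, N)%:R * (N ^_ l)%:R * z ^+ N =
  if (l <= n)%N then n`!%:R / (n - l)`!%:R * (1 + z) ^+ (n - l) * z ^+ l else 0.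
Proof.
case: leqP => [leln|ltnl]; last first.
  rewrite big_nat big1 // => N /andP[_ leN].
  by rewrite ffact_small ?mulr0 ?mul0r //; lia.
rewrite (big_cat_nat (n := l)) /=; [|by []|by lia].
rewrite [X in X + _]big_nat big1 ?add0r; last first.
  by move=> N /andP[_ leN]; rewrite ffact_small ?mulr0 ?mul0r.
rewrite -{1}[l]add0n big_addn subSn // exprDn.
rewrite -[X in _ * X * _](big_mkord xpredT
  (fun i => (1 ^+ (n - l - i) * z ^+ i) *+ 'C(n - l, i))).
rewrite mulr_sumr mulr_suml; apply: eq_big_nat => i /andP[_ lei].
rewrite expr1n mul1r -[z ^+ i *+ _]mulr_natl exprD !mulrA; congr (_ * _ * _).
have f0 := @fact_natr_neq0 K.
apply: (mulIf (f0 (n - l)%N)); rewrite [RHS]mulrAC divfK //.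
rewrite -!natrM; congr (_%:R).
have h1 := @bin_fact n (i + l) ltac:(lia).
have h2 := @bin_fact (n - l) i ltac:(lia).
have h3 := @ffact_fact (i + l) l ltac:(lia).
rewrite addnK in h3.
rewrite (_ : (n - (i + l) = n - l - i)%N) in h1; last by lia.
by rewrite -h1 -h2 -h3; lia.
Qed.

Lemma limn_series_terminating (K : numFieldType) (u : nat -> K) (p : nat) :
  (forall j, (p <= j)%N -> u j = 0) ->
  limn (series u) = \sum_(0 <= j < p) u j.
Proof.
move=> u0; apply/(cvg_lim (@norm_hausdorff _ _)).
apply: cvg_near_cst; near=> q.
have pq : (p <= q)%N by near: q; exact: nbhs_infty_ge.
rewrite /series /= (big_cat_nat (n := p)) //= [X in _ + X]big_nat.
by rewrite [X in _ + X]big1 ?addr0 // => j /andP[pj _]; exact: u0.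
Unshelve. all: by end_near.
Qed.

Lemma sum_even_support (K : numFieldType) (g : nat -> K) (p : nat) :
  (forall i, g (2 * i).+1 = 0) ->
  \sum_(0 <= N < 2 * p) g N = \sum_(0 <= j < p) g (2 * j)%N.
Proof.
move=> g0; elim: p => [|p IHp]; first by rewrite !big_geq.
rewrite (_ : (2 * p.+1 = (2 * p).+2)%N); last by lia.
by rewrite !big_nat_recr //= g0 addr0 IHp.
Qed.

(** * Expansion in falling factorials *)

(** Chu-Vandermonde with y = 1/2, since C(2r,r) = 4^r (1/2)_r / r! for r = m - k. *)
Lemma central_bin_convolution (K : numFieldType) (x : K) (m : nat) :
  \sum_(0 <= k < m.+1) 2 ^+ k / k`!%:R * 'C(2 * m - 2 * k, m - k)%:R *
    (2 ^+ k * poch x k) = 4 ^+ m / m`!%:R * poch (x + 1 / 2) m.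
Proof.
have f0 := @fact_natr_neq0 K.
rewrite poch_vandermonde mulr_sumr; apply: eq_big_nat => k /andP[_ lekm].
rewrite -mulnBr central_bin -(bin_fact (n := m) (m := k)) //.
have -> : 4 ^+ m = 4 ^+ k * 4 ^+ (m - k) :> K by rewrite -exprD subnKC.
have -> : 4 ^+ k = 2 ^+ k * 2 ^+ k :> K.
  by rewrite -exprMn; congr (_ ^+ _); ring.
have b0 : 'C(m, k)%:R != 0 :> K by rewrite pnatr_eq0 -lt0n bin_gt0.
by rewrite !natrM; field; rewrite b0 !f0.
Qed.

(* (2k-2l-1)!! binom(2k-l-1, l-1) = (2k-l-1)! / ((l-1)! (k-l)! 2^(k-l)); up to
   sign, the coefficient of N^_l in N (N - 2) ... (N - 2k + 2). *)
Definition bessel_coef (K : numFieldType) (k l : nat) : K :=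
  if l is l'.+1 then
    if (l' < k)%N then
      (2 * (k - l) + l')`!%:R / (l'`! * (k - l)`! * 2 ^ (k - l))%:R
    else 0
  else (k == 0)%:R.

Lemma ext_binom_nat (K : numFieldType) (a w : nat) :
  ext_binom (a%:R : K) w%:Z = 'C(a, w)%:R.
Proof.
have f0 := fact_natr_neq0 K w.
apply: (mulIf f0); rewrite /ext_binom divfK // -natrM bin_ffact.
elim: w {f0} => [|w IHw]; first by rewrite big_ord0.
by rewrite big_ord_recr /= IHw ffact_natrSr.
Qed.

Lemma bessel_coefE (K : numFieldType) (k l : nat) : (l <= k)%N ->
  (odd_dfact (k - l))%:R * ext_binom (2 * k%:R - l%:R - 1 : K) (l%:Z - 1) =
  bessel_coef K k l.
Proof.
case: l => [|l] ltlk.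
  (* For l = 0 the lower index is -1, and the upper one, 2k - 1, equals -1 only when k = 0. *)
  rewrite /ext_binom /= eqxx andbT.
  case: k {ltlk} => [|k].
    by rewrite mulr0 subr0 sub0r eqxx mulr1 /odd_dfact big_ord0.
  by rewrite subr0 subr_eq -natrM addNr pnatr_eq0 mulr0.
rewrite (_ : l.+1%:Z - 1 = l%:Z); last by lia.
rewrite (_ : 2 * k%:R - l.+1%:R - 1 = (2 * (k - l.+1) + l)%:R :> K); last first.
  by rewrite natrD natrM natrB // -natr1; ring.
rewrite ext_binom_nat /bessel_coef ltlk.
move: (k - l.+1)%N => r.
have f0 := @fact_natr_neq0 K.
rewrite -(bin_fact (n := 2 * r + l) (m := l)); last by lia.
rewrite addnK !natrM -poch_half odd_dfact_poch natrX.
have -> : 4 ^+ r = 2 ^+ r * 2 ^+ r :> K.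
  by rewrite -exprMn; congr (_ ^+ _); ring.
by field; rewrite !f0 expf_neq0 // pnatr_eq0.
Qed.

(** The effect on coefficients of multiplying by 2k - N, with the signs (-1)^l kept outside. *)
Lemma bessel_coef_rec (K : numFieldType) (k l : nat) :
  bessel_coef K k.+1 l.+1 =
  ((2 * k)%:R - l.+1%:R) * bessel_coef K k l.+1 + bessel_coef K k l.
Proof.
have f0 := @fact_natr_neq0 K.
have e0 i : 2 ^+ i != 0 :> K by rewrite expf_neq0 // pnatr_eq0.
rewrite /bessel_coef ltnS subSS.
case: (ltngtP l k) => [ltlk|ltkl|->]; last 2 first.
- case: l ltkl => [|l] ltkl; first by lia.
  by rewrite ifF ?mulr0 ?addr0 //; apply/negbTE; lia.
- rewrite subnn mulr0 add0r; case: k => [|k].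
    by rewrite /= fact0 !mul1n divr1.
  rewrite /= ltnSn !(expn0, muln1, fact0) !add0n !divff //.
have -> : (k - l = (k - l.+1).+1)%N by lia.
(* With r = k - l - 1 all subtractions disappear and the claim becomes an identity between
   factorials. *)
have -> : k = (l.+1 + (k - l.+1))%N by lia.
rewrite addKn; move: (k - l.+1)%N => r.
case: l {ltlk} => [|l].
  rewrite !addn0 /= addr0 (_ : (2 * r.+1 = (2 * r).+2)%N); last by lia.
  rewrite !factS !natrM !natrX !exprS.
  by field; rewrite !f0 e0 nat1r pnatr_eq0.
rewrite ifT; last by lia.
rewrite (_ : (2 * r.+1 + l.+1 = (2 * r + l).+3)%N); last by lia.
rewrite (_ : (2 * r.+1 + l = (2 * r + l).+2)%N); last by lia.
rewrite (_ : (2 * r + l.+1 = (2 * r + l).+1)%N); last by lia.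
rewrite !factS !natrM !natrX !exprS.
by field; rewrite !f0 e0 !nat1r !pnatr_eq0.
Qed.

(** Induction on k: the new factor is 2k - N, and (2k - N) N^_l = (2k - l) N^_l - N^_(l+1). *)
Lemma poch_ffact (K : numFieldType) (N k : nat) :
  2 ^+ k * poch (- N%:R / 2) k =
  \sum_(0 <= l < k.+1) bessel_coef K k l * ((-1) ^+ l * (N ^_ l)%:R).
Proof.
elim: k => [|k IHk]; first by rewrite big_nat1 poch0 !mulr1.
rewrite pochSr exprS.
have -> : 2 * 2 ^+ k * (poch (- N%:R / 2) k * (- N%:R / 2 + k%:R)) =
  2 ^+ k * poch (- N%:R / 2) k * ((2 * k)%:R - N%:R) :> K.
  by rewrite natrM; field.
rewrite IHk mulr_suml.
have step l : bessel_coef K k l * ((-1) ^+ l * (N ^_ l)%:R) *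
    ((2 * k)%:R - N%:R) =
    ((2 * k)%:R - l%:R) * bessel_coef K k l * ((-1) ^+ l * (N ^_ l)%:R) +
    bessel_coef K k l * ((-1) ^+ l.+1 * (N ^_ l.+1)%:R).
  by rewrite ffact_natrSr exprS; ring.
under eq_bigr => l _ do rewrite step.
rewrite big_split /=.
rewrite [RHS]big_nat_recl //.
under [in RHS]eq_bigr => l _ do rewrite bessel_coef_rec mulrDl.
rewrite [in RHS]big_split /= addrA; congr (_ + _).
(* The ranges differ only by end terms, all zero: at l = k + 1 the coefficient of level k vanishes,
   and at l = 0 either k or the coefficient does. *)
rewrite [LHS]big_nat_recl // [in RHS]big_nat_recr //= ltnn.
rewrite !(mulr0, mul0r) addr0 add0r; case: k {IHk step} => [|k] /=.
  by rewrite muln0 subr0 !mul0r add0r.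
by rewrite mulr0 mul0r add0r.
Qed.

(** * Even parts and assembly *)

(** [falling_binomial_sum] at z and at -z; the sign of (-z)^l cancels (-1)^l on (1 - z)^(n-l) and
    leaves it on (1 + z)^(n-l). *)
Lemma even_binomial_sum (K : numFieldType) (n l : nat) (z : K) :
  n`!%:R * (if (l <= n)%N then
    ((1 - z) ^+ (n - l) + (-1) ^+ l * (1 + z) ^+ (n - l)) * z ^+ l /
      (n - l)`!%:R else 0) =
  \sum_(0 <= N < n.+1)
    'C(n, N)%:R * (z ^+ N + (- z) ^+ N) * ((-1) ^+ l * (N ^_ l)%:R).
Proof.
transitivity ((-1) ^+ l *
    (\sum_(0 <= N < n.+1) 'C(n, N)%:R * (N ^_ l)%:R * z ^+ N +
     \sum_(0 <= N < n.+1) 'C(n, N)%:R * (N ^_ l)%:R * (- z) ^+ N)).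
  rewrite !falling_binomial_sum; case: leqP => _; last by rewrite addr0 !mulr0.
  have sign2 : (-1) ^+ l * (-1) ^+ l = 1 :> K.
    by rewrite -exprMn mulrNN mulr1 expr1n.
  by rewrite (exprNn z) !mulrDr !mulrDl -[in LHS](mul1r (_ ^+ _ * z ^+ l))
     -[X in X * (_ * z ^+ l)]sign2; ring.
by rewrite -big_split mulr_sumr; apply: eq_bigr => N _ /=; ring.
Qed.

Lemma bessel_convolution (K : numFieldType) (m N : nat) :
  \sum_(0 <= k < m.+1) 2 ^+ k / k`!%:R * 'C(2 * m - 2 * k, m - k)%:R *
    (\sum_(0 <= l < k.+1) bessel_coef K k l * ((-1) ^+ l * (N ^_ l)%:R)) =
  4 ^+ m / m`!%:R * poch ((1 - N%:R) / 2) m.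
Proof.
rewrite (_ : (1 - N%:R) / 2 = - N%:R / 2 + 1 / 2 :> K); last by ring.
by rewrite -central_bin_convolution; apply: eq_bigr => k _; rewrite poch_ffact.
Qed.

Lemma hyp2F1_even_sum (K : numFieldType) (m n : nat) (z : K) :
  hyp2F1 (- n%:R / 2) ((1 - n%:R) / 2) (1 / 2 - m%:R) (z ^+ 2) =
  \sum_(0 <= N < n.+1) 'C(n, N)%:R * (z ^+ N + (- z) ^+ N) *
    (poch ((1 - N%:R) / 2) m / (2 * poch (1 / 2) m)).
Proof.
rewrite /hyp2F1 (@limn_series_terminating _ _ n.+1); last first.
  by move=> j ltnj; rewrite hyp2F1_term bin_small ?mul0r //; lia.
set g := fun N => 'C(n, N)%:R * (z ^+ N + (- z) ^+ N) *
    (poch ((1 - N%:R) / 2) m / (2 * poch (1 / 2) m)).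
(* Zero terms are added so that the even indices N = 2j run over exactly j <= n; odd N cancel, and
   even N count twice, hence the 2 in the denominator. *)
have -> : \sum_(0 <= N < n.+1) g N = \sum_(0 <= N < 2 * n.+1) g N.
  rewrite [RHS](big_cat_nat (n := n.+1)) //=; last by lia.
  rewrite [X in _ = _ + X]big_nat [X in _ = _ + X]big1 ?addr0 //.
  move=> N /andP[ltnN _].
  by rewrite /g bin_small // !mul0r.
rewrite sum_even_support; last first.
  move=> i; rewrite /g exprNn -signr_odd /= mul2n odd_double /= mulN1r subrr.
  by rewrite mulr0 mul0r.
apply: eq_bigr => j _.
rewrite hyp2F1_term /g [(- z) ^+ _]exprM sqrrN -exprM.
have p0 := poch_half_neq0 K m.
by field.
Qed.

Lemma hyp2F1_bessel_sum (K : numFieldType) (m n : nat) (z : K) :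
  hyp2F1 (- n%:R / 2) ((1 - n%:R) / 2) (1 / 2 - m%:R) (z ^+ 2) =
  n`!%:R / (2 * 'C(2 * m, m)%:R) *
  \sum_(0 <= k < m.+1)
    2 ^+ k / k`!%:R * 'C(2 * m - 2 * k, m - k)%:R *
    \sum_(0 <= l < k.+1)
      (if (l <= n)%N then
         (odd_dfact (k - l))%:R / (n - l)`!%:R *
         ext_binom (2 * k%:R - l%:R - 1) (l%:Z - 1) *
         ((1 - z) ^+ (n - l) + (-1) ^+ l * (1 + z) ^+ (n - l)) * z ^+ l
       else 0).
Proof.
have p0 := poch_half_neq0 K m.
have f0 := fact_natr_neq0 K m.
have e0 : 4 ^+ m != 0 :> K by rewrite expf_neq0 // pnatr_eq0.
set S := \sum_(0 <= k < m.+1) _.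
have -> : n`!%:R / (2 * 'C(2 * m, m)%:R) * S =
    (2 * 'C(2 * m, m)%:R)^-1 * (n`!%:R * S) by ring.
(* Interchange of sums: for fixed k and l the sum over N is [even_binomial_sum], for fixed N the sum
   over k and l is [bessel_convolution]. *)
have -> : n`!%:R * S = \sum_(0 <= N < n.+1) 'C(n, N)%:R *
    (z ^+ N + (- z) ^+ N) * (4 ^+ m / m`!%:R * poch ((1 - N%:R) / 2) m).
  under [RHS]eq_bigr => N _ do rewrite -bessel_convolution mulr_sumr.
  rewrite [RHS]exchange_big /= mulr_sumr; apply: eq_bigr => k _.
  rewrite mulrCA mulr_sumr.
  under [RHS]eq_bigr => N _ do rewrite mulrCA mulr_sumr.
  rewrite -[RHS]mulr_sumr [X in _ = _ * X]exchange_big /=; congr (_ * _).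
  apply: eq_big_nat => l /andP[_ lelk].
  under [RHS]eq_bigr => N _ do rewrite mulrCA.
  rewrite -mulr_sumr -even_binomial_sum -bessel_coefE //.
  by case: leqP => _; [ring | rewrite !mulr0].
rewrite hyp2F1_even_sum mulr_sumr; apply: eq_bigr => N _.
(* The prefactor C(2m,m) = 4^m (1/2)_m / m! cancels 4^m / m! and leaves the normalisation 1 /
   (1/2)_m. *)
by rewrite central_bin; field; rewrite p0 f0 e0.
Qed.

Theorem theorem2p2 (R : realType) (m n : nat) (hm : (0 < m)%N) (hn : (0 < n)%N)
    (z : R[i]) :
  hyp2F1 (- n%:R / 2) ((1 - n%:R) / 2) (1 / 2 - m%:R) (z ^+ 2) =
  n`!%:R / (2 * 'C(2 * m, m)%:R) *
  \sum_(0 <= k < m.+1)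
    2 ^+ k / k`!%:R * 'C(2 * m - 2 * k, m - k)%:R *
    \sum_(0 <= l < k.+1)
      (* the terms with l > n are 0, as 1 / (n - l)! = 0 there *)
      (if (l <= n)%N then
         (odd_dfact (k - l))%:R / (n - l)`!%:R *
         ext_binom (2 * k%:R - l%:R - 1) (l%:Z - 1) *
         ((1 - z) ^+ (n - l) + (-1) ^+ l * (1 + z) ^+ (n - l)) * z ^+ l
       else 0).
Proof. exact: hyp2F1_bessel_sum. Qed.
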